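(* (BGG reciprocity for $A^-$.) For every $n\ge 0$, the projective module $P_n$ has a finite filtration by standard modules $M_m$ with $m\le n$: in the chain of submodules $$P_n=P_n(\le n)\supset P_n(\le n-1)\supset\dots\supset P_n(\le 0)\supset P_n(\le -1)=0,$$ each quotient $P_n(\le m)/P_n(\le m-1)$, $0\le m\le n$, is isomorphic to a direct sum of copies of $M_m$. Let $[P_n:M_m]$ denote the number of copies of $M_m$ in this filtration (with $[P_n:M_m]=0$ for $m>n$). Then for all $n,m\ge 0$ $$[P_n:M_m]=[M_m:L_n],$$ both sides being equal to $\binom{n}{m}$.
   Context: Let $\mathbf{k}$ be a field. For $m,n\ge 0$ let ${}_mB^-_n$ be the set of isotopy classes of planar diagrams in the strip $0\le x\le 1$ with $m$ points on the line $x=0$ and $n$ points on the line $x=1$ (numbered from bottom to top), in which $w$ of the left points are joined to $w$ of the right points by $w$ pairwise disjoint arcs (''larcs''), and each remaining left (resp. right) point is the endpoint of a short arc, a ''left sarc'' (resp. ''right sarc''), whose other end lies in the interior of the strip; the projection to the $x$-axis has no critical points. Equivalently, a diagram is a pair of subsets $I\subseteq\{1,\dots,m\}$, $J\subseteq\{1,\dots,n\}$ with $|I|=|J|=w$, the larcs being given by the order-preserving bijection $I\to J$. The number $w$ of larcs is the width. The (non-unital, associative) $\mathbf{k}$-algebra $A^-$ has basis $B^-=\bigsqcup_{m,n}{}_mB^-_n$. The product $yz$ of $y\in{}_mB^-_n$ and $z\in{}_kB^-_l$ is $0$ if $n\neq k$; if $n=k$ it is the horizontal concatenation ($y$ on the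 left, $z$ on the right), except that $yz=0$ if the concatenation contains a floating arc (i.e. some middle point is both the endpoint of a right sarc of $y$ and of a left sarc of $z$). A larc concatenated with a sarc becomes a sarc. $1_n\in{}_nB^-_n$ is the diagram with $n$ larcs; the $1_n$ are mutually orthogonal idempotents. All modules are left $A^-$-modules $M$ with $M=\bigoplus_{n\ge0}1_nM$. $P_n=A^-1_n$, with basis $B^-_n=\bigsqcup_{m\ge0}{}_mB^-_n$. $M_n$ (standard module) is the quotient of $P_n$ by the submodule spanned by diagrams having at least one right sarc. $L_n=\mathbf{k}1_n$ is the one-dimensional module on which every element of $B^-$ other than $1_n$ acts by zero. $P_n(\le m)$ is the submodule of $P_n$ spanned by diagrams in $B^-_n$ of width at most $m$. For a module $M$ with all $1_nM$ finite-dimensional, the multiplicity is defined by $[M:L_n]:=\dim_{\mathbf{k}}(1_nM)$. *)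

(* Defs.v *)
From HB Require Import structures.
From mathcomp Require Import mathcomp_extra boolp classical_sets.
From mathcomp Require Import all_boot all_order all_algebra finmap.
From mathcomp Require Import monalg.

Set Implicit Arguments.
Unset Strict Implicit.
Unset Printing Implicit Defensive.

Import Order.TTheory GRing.Theory Num.Theory.
Local Open Scope ring_scope.

(* A diagram with m left and n right endpoints is the pair (I, J) of the sets
   of left and right endpoints of its larcs; the larcs are the graph of the
   order-preserving bijection I -> J, all other endpoints carry sarcs. *)
Definition diag (m n : nat) :=
  {IJ : {set 'I_m} * {set 'I_n} | #|IJ.1| == #|IJ.2|}.

Section Diagrams.

Definition lset m n (y : diag m n) : {set 'I_m} := (val y).1.
Definition rset m n (y : diag m n) : {set 'I_n} := (val y).2.
Definition dwidth m n (y : diag m n) : nat := #|lset y|.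

Definition posn m (I : {set 'I_m}) (i : 'I_m) : nat :=
  #|[set i' in I | (i' < i)%N]|.

(* The order-preserving bijection sends the r-th element of I to the r-th
   element of J. *)
Definition larc m n (y : diag m n) (i : 'I_m) (j : 'I_n) : bool :=
  [&& i \in lset y, j \in rset y & posn (lset y) i == posn (rset y) j].

Lemma card_lrset m n (y : diag m n) : #|lset y| = #|rset y|.
Proof. exact/eqP/(valP y). Qed.

Lemma posn_lt m (I : {set 'I_m}) i : i \in I -> (posn I i < #|I|)%N.
Proof.
move=> iI; apply: proper_card; apply/properP; split.
  by apply/subsetP => x; rewrite inE => /andP[].
by exists i => //; rewrite inE ltnn andbF.
Qed.

Lemma posn_mono m (I : {set 'I_m}) (i j : 'I_m) :
  i \in I -> (i < j)%N -> (posn I i < posn I j)%N.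
Proof.
move=> iI ij; apply: proper_card; apply/properP; split.
  apply/subsetP => x; rewrite !inE => /andP[-> xi].
  exact: ltn_trans xi ij.
by exists i; rewrite !inE iI ?ij // ltnn.
Qed.

Lemma posn_ltE m (I : {set 'I_m}) (i j : 'I_m) :
  i \in I -> j \in I -> (posn I i < posn I j)%N = (i < j)%N.
Proof.
move=> iI jI; case: (ltngtP i j) => [ij|ji|/val_inj->].
- exact: posn_mono.
- by apply/negbTE; rewrite -leqNgt ltnW // posn_mono.
- by rewrite ltnn.
Qed.

Lemma posn_inj m (I : {set 'I_m}) : {in I &, injective (posn I)}.
Proof.
move=> i j iI jI e; apply/val_inj/eqP.
by rewrite eqn_leq leqNgt [X in _ && X]leqNgt -(posn_ltE iI jI) -(posn_ltE jI iI) e ltnn.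
Qed.

Lemma posn_onto m (I : {set 'I_m}) r :
  (r < #|I|)%N -> exists2 i, i \in I & posn I i = r.
Proof.
move=> rI; pose f (i : 'I_m) : 'I_#|I| := insubd (Ordinal rI) (posn I i).
have fE i : i \in I -> f i = posn I i :> nat.
  by move=> iI; rewrite val_insubd posn_lt.
have finj : {in I &, injective f}.
  by move=> i j iI jI /(congr1 val); rewrite /= !fE //; apply: posn_inj.
have /setP/(_ (Ordinal rI)) : f @: I = [set: 'I_#|I|].
  by apply/eqP; rewrite eqEcard subsetT cardsT card_ord card_in_imset //=.
rewrite inE => /imsetP[i iI /(congr1 val) /= e].
by exists i => //; rewrite -fE.
Qed.

Lemma larc_l m n (y : diag m n) i : i \in lset y -> exists j, larc y i j.
Proof.
move=> iI; have := posn_lt iI; rewrite card_lrset.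
case/posn_onto => j jJ e; exists j.
by rewrite /larc iI jJ e eqxx.
Qed.

Lemma larc_r m n (y : diag m n) j : j \in rset y -> exists i, larc y i j.
Proof.
move=> iI; have := posn_lt iI; rewrite -card_lrset.
case/posn_onto => i jJ e; exists i.
by rewrite /larc iI jJ e eqxx.
Qed.

Lemma larc_lset m n (y : diag m n) i j : larc y i j -> i \in lset y.
Proof. by case/and3P. Qed.

Lemma larc_rset m n (y : diag m n) i j : larc y i j -> j \in rset y.
Proof. by case/and3P. Qed.

Lemma larc_lt m n (y : diag m n) i j i' j' :
  larc y i j -> larc y i' j' -> (i < i')%N = (j < j')%N.
Proof.
case/and3P=> iI jJ /eqP e /and3P[iI' jJ' /eqP e'].
by rewrite -(@posn_ltE _ (lset y)) // e e' posn_ltE.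
Qed.

Lemma larc_funr m n (y : diag m n) i j j' : larc y i j -> larc y i j' -> j = j'.
Proof.
case/and3P=> _ jJ /eqP e /and3P[_ jJ' /eqP e'].
by apply: (posn_inj jJ jJ'); rewrite -e.
Qed.

Lemma larc_funl m n (y : diag m n) i i' j : larc y i j -> larc y i' j -> i = i'.
Proof.
case/and3P=> iI _ /eqP e /and3P[iI' _ /eqP e'].
by apply: (posn_inj iI iI'); rewrite e.
Qed.

(* A relation which is an order isomorphism from I onto J has domain and
   codomain of the same size and is the larc relation of (I, J). *)
Section OrderRel.
Variables (m n : nat) (R : 'I_m -> 'I_n -> bool).
Hypothesis R_lt :
  forall i j i' j', R i j -> R i' j' -> (i < i')%N = (j < j')%N.

Let Rl i j j' : R i j -> R i j' -> j = j'.
Proof.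
move=> h h'; apply/val_inj/eqP; rewrite eqn_leq leqNgt [X in _ && X]leqNgt.
by rewrite -(R_lt h h') -(R_lt h' h) ltnn.
Qed.

Let Rr i i' j : R i j -> R i' j -> i = i'.
Proof.
move=> h h'; apply/val_inj/eqP; rewrite eqn_leq leqNgt [X in _ && X]leqNgt.
by rewrite (R_lt h h') (R_lt h' h) ltnn.
Qed.

Lemma card_orel (A : {set 'I_m}) (B : {set 'I_n}) :
  (forall i, i \in A -> exists2 j, j \in B & R i j) ->
  (forall j, j \in B -> exists2 i, i \in A & R i j) -> #|A| = #|B|.
Proof.
move=> hA hB.
have leAB : (#|A| <= #|B|)%N.
  have [->|[i0 i0A]] := set_0Vmem A; first by rewrite cards0.
  have [j0 _ _] := hA _ i0A; pose f i := odflt j0 [pick j in B | R i j].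
  have fP i : i \in A -> (f i \in B) && R i (f i).
    move=> /hA[j jB rij]; rewrite /f; case: pickP => [//|/(_ j)].
    by rewrite jB rij.
  have finj : {in A &, injective f}.
    move=> i i' /fP/andP[_ h] /fP/andP[_ h'] e.
    by rewrite -e in h'; apply: Rr h h'.
  rewrite -(card_in_imset finj) subset_leq_card //.
  by apply/subsetP => _ /imsetP[i /fP/andP[? _] ->].
have leBA : (#|B| <= #|A|)%N.
  have [->|[i0 i0A]] := set_0Vmem B; first by rewrite cards0.
  have [j0 _ _] := hB _ i0A; pose f i := odflt j0 [pick j in A | R j i].
  have fP i : i \in B -> (f i \in A) && R (f i) i.
    move=> /hB[j jB rij]; rewrite /f; case: pickP => [//|/(_ j)].
    by rewrite jB rij.
  have finj : {in B &, injective f}.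
    move=> i i' /fP/andP[_ h] /fP/andP[_ h'] e.
    by rewrite -e in h'; apply: Rl h h'.
  rewrite -(card_in_imset finj) subset_leq_card //.
  by apply/subsetP => _ /imsetP[i /fP/andP[? _] ->].
by apply/eqP; rewrite eqn_leq leAB.
Qed.

Lemma posn_orel (A : {set 'I_m}) (B : {set 'I_n}) i j :
  (forall i, i \in A -> exists2 j, j \in B & R i j) ->
  (forall j, j \in B -> exists2 i, i \in A & R i j) ->
  i \in A -> j \in B -> (posn A i == posn B j) = R i j.
Proof.
move=> hA hB iA jB.
have RE i' j' : R i' j' -> posn A i' = posn B j'.
  move=> rij; apply: card_orel.
    move=> x; rewrite inE => /andP[/hA[y yB rxy] xi].
    by exists y => //; rewrite inE yB -(R_lt rxy rij).
  move=> y; rewrite inE => /andP[/hB[x xA rxy] yj].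
  by exists x => //; rewrite inE xA (R_lt rxy rij).
apply/eqP/idP => [e|]; last exact: RE.
have [j' j'B rij'] := hA _ iA.
suff <- : j' = j by [].
by apply: (posn_inj j'B jB); rewrite -e (RE _ _ rij').
Qed.
End OrderRel.

Section Concatenation.
Variables (m n l : nat) (y : diag m n) (z : diag n l).

Definition floating : bool :=
  [exists j : 'I_n, (j \notin rset y) && (j \notin lset z)].

Definition cat_lset : {set 'I_m} := [set i | [exists j in lset z, larc y i j]].
Definition cat_rset : {set 'I_l} := [set p | [exists j in rset y, larc z j p]].

Definition cat_larc i p : bool := [exists j, larc y i j && larc z j p].

Lemma cat_larc_lt i p i' p' :
  cat_larc i p -> cat_larc i' p' -> (i < i')%N = (p < p')%N.
Proof.
move=> /existsP[j /andP[a b]] /existsP[j' /andP[a' b']].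
by rewrite (larc_lt a a') (larc_lt b b').
Qed.

Lemma cat_larc_lset i p : cat_larc i p -> i \in cat_lset.
Proof.
case/existsP=> j /andP[a b]; rewrite inE; apply/existsP; exists j.
by rewrite a (larc_lset b).
Qed.

Lemma cat_larc_rset i p : cat_larc i p -> p \in cat_rset.
Proof.
case/existsP=> j /andP[a b]; rewrite inE; apply/existsP; exists j.
by rewrite b (larc_rset a).
Qed.

Lemma cat_larc_l i : i \in cat_lset -> exists2 p, p \in cat_rset & cat_larc i p.
Proof.
rewrite inE => /existsP[j /andP[/larc_l[p jp] ij]].
have c : cat_larc i p by apply/existsP; exists j; rewrite ij.
by exists p => //; apply: cat_larc_rset c.
Qed.

Lemma cat_larc_r p : p \in cat_rset -> exists2 i, i \in cat_lset & cat_larc i p.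
Proof.
rewrite inE => /existsP[j /andP[/larc_r[i ij] jp]].
have c : cat_larc i p by apply/existsP; exists j; rewrite ij.
by exists i => //; apply: cat_larc_lset c.
Qed.

Lemma dcat_subproof : #|(cat_lset, cat_rset).1| == #|(cat_lset, cat_rset).2|.
Proof.
by apply/eqP/(card_orel cat_larc_lt); [apply: cat_larc_l|apply: cat_larc_r].
Qed.

Definition dcat : diag m l := exist _ (cat_lset, cat_rset) dcat_subproof.

Lemma larc_dcat i p : larc dcat i p = cat_larc i p.
Proof.
apply/idP/idP => [/and3P[iI pJ]|c].
  by rewrite (posn_orel cat_larc_lt cat_larc_l cat_larc_r).
rewrite /larc (cat_larc_lset c) (cat_larc_rset c) /=.
by rewrite (posn_orel cat_larc_lt cat_larc_l cat_larc_r) //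
  ?(cat_larc_lset c) ?(cat_larc_rset c).
Qed.

(* None stands for the zero product. *)
Definition dmul : option (diag m l) := if floating then None else Some dcat.

Lemma dwidth_dcat : (dwidth dcat <= dwidth z)%N.
Proof.
rewrite /dwidth card_lrset.
have -> : #|lset z| = #|rset z| by apply: card_lrset.
apply: subset_leq_card; apply/subsetP => p; rewrite inE.
by case/existsP=> j /andP[_ /larc_rset].
Qed.

Lemma rset_dcat : rset dcat \subset rset z.
Proof.
apply/subsetP => p; rewrite inE.
by case/existsP=> j /andP[_ /larc_rset].
Qed.

End Concatenation.

Lemma done_subproof n : #|([set: 'I_n], [set: 'I_n]).1|
  == #|([set: 'I_n], [set: 'I_n]).2|.
Proof. by []. Qed.

Definition done n : diag n n :=
  exist _ ([set: 'I_n], [set: 'I_n]) (done_subproof n).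

Lemma diag_eq m n (y z : diag m n) : lset y = lset z -> rset y = rset z -> y = z.
Proof.
move=> a b; apply: val_inj; rewrite /lset /rset in a b.
by rewrite [val y]surjective_pairing [val z]surjective_pairing a b.
Qed.

Lemma larc_done n i j : larc (done n) i j = (i == j).
Proof.
rewrite /larc !inE /=; apply/eqP/eqP => [|->//].
by apply: posn_inj; rewrite inE.
Qed.

Lemma dmul1d m n (y : diag m n) : dmul (done m) y = Some y.
Proof.
rewrite /dmul ifF; last first.
  by apply/negbTE/existsPn => j; rewrite inE.
congr Some; apply: diag_eq; apply/setP => i; rewrite inE.
  apply/existsP/idP => [[j /andP[jl]]|il].
    by rewrite larc_done => /eqP->.
  by exists i; rewrite il larc_done eqxx.
apply/existsP/idP => [[j /andP[jl /larc_rset]]//|/larc_r[j jl]].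
by exists j; rewrite inE.
Qed.

Lemma dmuld1 m n (y : diag m n) : dmul y (done n) = Some y.
Proof.
rewrite /dmul ifF; last first.
  by apply/negbTE/existsPn => j; rewrite !inE andbF.
congr Some; apply: diag_eq; apply/setP => i; rewrite inE.
  apply/existsP/idP => [[j /andP[jl /larc_lset]]//|/larc_l[j jl]].
  by exists j; rewrite inE.
apply/existsP/idP => [[j /andP[jl]]|il].
  by rewrite larc_done => /eqP<-.
by exists i; rewrite il larc_done eqxx.
Qed.

Lemma dcatA m n k l (y : diag m n) (z : diag n k) (w : diag k l) :
  dcat (dcat y z) w = dcat y (dcat z w).
Proof.
apply: diag_eq; apply/setP => i; rewrite !inE.
  apply/existsP/existsP => [[p /andP[pw]]|[j /andP[]]].
    rewrite larc_dcat => /existsP[j /andP[yij zjp]].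
    exists j; rewrite yij andbT inE; apply/existsP; exists p.
    by rewrite pw.
  rewrite inE => /existsP[p /andP[pw zjp]] yij.
  exists p; rewrite pw larc_dcat; apply/existsP; exists j.
  by rewrite yij.
apply/existsP/existsP => [[p /andP[]]|[j /andP[jy]]].
  rewrite inE => /existsP[j /andP[jy zjp]] wpi.
  exists j; rewrite jy larc_dcat; apply/existsP; exists p.
  by rewrite zjp.
rewrite larc_dcat => /existsP[p /andP[zjp wpi]].
exists p; rewrite wpi andbT inE; apply/existsP; exists j.
by rewrite jy.
Qed.

Lemma floatingPn m n l (y : diag m n) (z : diag n l) :
  reflect (forall j, j \notin rset y -> j \in lset z) (~~ floating y z).
Proof.
apply: (iffP existsPn) => h j; have := h j.
  by rewrite negb_and !negbK => /orP[->|].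
case: (j \in rset y) => //=.
by move=> /(_ isT) ->.
Qed.

Lemma floatingA m n k l (y : diag m n) (z : diag n k) (w : diag k l) :
  floating y z || floating (dcat y z) w = floating z w || floating y (dcat z w).
Proof.
apply/negb_inj; rewrite !negb_or; apply/andP/andP.
  case=> /floatingPn h1 /floatingPn h2; split; apply/floatingPn.
    move=> p pz; apply: h2; apply: contra pz => /(subsetP (rset_dcat y z)).
    by [].
  move=> j jy; have /larc_l[p jp] := h1 _ jy.
  rewrite inE; apply/existsP; exists p; rewrite jp andbT.
  apply: h2; rewrite inE; apply/existsPn => j'.
  apply/negP => /andP[j'y j'p].
  by rewrite (larc_funl jp j'p) j'y in jy.
case=> /floatingPn h1 /floatingPn h2; split; apply/floatingPn.
  move=> j /h2; rewrite inE => /existsP[p /andP[_ /larc_lset]].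
  by [].
move=> p pn; have [pz|/h1//] := boolP (p \in rset z).
have [j jp] := larc_r pz.
have jy : j \notin rset y.
  by apply: contra pn => jy; rewrite inE; apply/existsP; exists j; rewrite jy.
have := h2 _ jy; rewrite inE => /existsP[p' /andP[p'w jp']].
by rewrite (larc_funr jp jp').
Qed.

Lemma dmulA m n k l (y : diag m n) (z : diag n k) (w : diag k l) :
  obind (fun yz => dmul yz w) (dmul y z) = obind (dmul y) (dmul z w).
Proof.
have := floatingA y z w; rewrite /dmul.
case: (floating y z) => /=; case: (floating z w) => //=.
- by move=> <-.
- by move=> ->.
- by rewrite dcatA => ->.
Qed.

End Diagrams.

Definition bdiag := {mn : nat * nat & diag mn.1 mn.2}.
HB.instance Definition _ := Choice.on bdiag.

Definition pack m n (y : diag m n) : bdiag :=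
  Tagged (fun mn : nat * nat => diag mn.1 mn.2) (y : diag (m, n).1 (m, n).2).

Definition lpts (x : bdiag) : nat := (tag x).1.
Definition rpts (x : bdiag) : nat := (tag x).2.
Definition width (x : bdiag) : nat := dwidth (tagged x).
Definition has_rsarc (x : bdiag) : bool := rset (tagged x) != [set: _].

Definition bmul (x y : bdiag) : option bdiag :=
  if rpts x =P lpts y is ReflectT e then
    omap (@pack _ _)
      (dmul (tagged x) (ecast k (diag k (rpts y)) (esym e) (tagged y)))
  else None.

Lemma bmul_pack m n l (y : diag m n) (z : diag n l) :
  bmul (pack y) (pack z) = omap (@pack _ _) (dmul y z).
Proof.
by rewrite /bmul /=; case: eqP => // e; rewrite (eq_axiomK e).
Qed.

Lemma bmul_neq x y : rpts x <> lpts y -> bmul x y = None.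
Proof. by rewrite /bmul; case: eqP. Qed.

Lemma bmul_pack_neq m n n' l (y : diag m n) (z : diag n' l) :
  n != n' -> bmul (pack y) (pack z) = None.
Proof. by move=> /eqP ne; apply: bmul_neq. Qed.

Lemma packP (x : bdiag) : exists m n (y : diag m n), x = pack y.
Proof. by case: x => -[m n] /= y; exists m, n, y. Qed.

Lemma bmulA x y z :
  obind (fun xy => bmul xy z) (bmul x y) = obind (bmul x) (bmul y z).
Proof.
have [m [n [{}x ->]]] := packP x; have [n' [k [{}y ->]]] := packP y.
have [k' [l [{}z ->]]] := packP z.
have [en|nn] := eqVneq n n'; last first.
  rewrite bmul_pack_neq //=; have [ek|nk] := eqVneq k k'; last first.
    by rewrite bmul_pack_neq.
  by subst k'; rewrite bmul_pack; case: dmul => //= d; rewrite bmul_pack_neq.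
subst n'; rewrite bmul_pack.
have [ek|nk] := eqVneq k k'; last first.
  rewrite [bmul (pack y) _]bmul_pack_neq //.
  by case: dmul => //= d; rewrite bmul_pack_neq.
subst k'; rewrite bmul_pack; have := dmulA x y z.
case: (dmul x y) => [d|]; case: (dmul y z) => [d'|] //=; rewrite ?bmul_pack.
- by move=> ->.
- by move=> ->.
- by move=> <-.
Qed.

Lemma bmul_width x y z : bmul x y = Some z -> (width z <= width y)%N.
Proof.
have [m [n [{}x ->]]] := packP x; have [n' [k [{}y ->]]] := packP y.
have [en|nn] := eqVneq n n'; last first.
  by rewrite bmul_pack_neq.
subst n'; rewrite bmul_pack /dmul; case: floating => //= -[<-].
exact: dwidth_dcat.
Qed.

Lemma bmul_rsarc x y z : bmul x y = Some z -> has_rsarc y -> has_rsarc z.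
Proof.
have [m [n [{}x ->]]] := packP x; have [n' [k [{}y ->]]] := packP y.
have [en|nn] := eqVneq n n'; last first.
  by rewrite bmul_pack_neq.
subst n'; rewrite bmul_pack /dmul; case: floating => //= -[<-].
rewrite /has_rsarc /=; apply: contra => /eqP e.
by rewrite -subTset -e rset_dcat.
Qed.

Section Algebra.
Variable k : fieldType.

Definition Aminus := {malg k[bdiag]}.
HB.instance Definition _ := GRing.Lmodule.on Aminus.

Definition bprod (x y : bdiag) : Aminus :=
  if bmul x y is Some z then << z >> else 0.

(* Locked only to keep unification from unfolding it; amulE unlocks. *)
Fact amul_key : unit. Proof. by []. Qed.
Definition amul : Aminus -> Aminus -> Aminus := locked_with amul_key (fun a b =>
  \sum_(x <- msupp a) \sum_(y <- msupp b) (a@_x * b@_y) *: bprod x y).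

Lemma amulE a b :
  amul a b = \sum_(x <- msupp a) \sum_(y <- msupp b) (a@_x * b@_y) *: bprod x y.
Proof. by rewrite /amul unlock. Qed.

Definition aone (n : nat) : Aminus := << pack (done n) >>.

Lemma amulw (d1 d2 : {fset bdiag}) a b :
  fsubset (msupp a) d1 -> fsubset (msupp b) d2 ->
  amul a b = \sum_(x <- d1) \sum_(y <- d2) (a@_x * b@_y) *: bprod x y.
Proof.
move=> s1 s2; rewrite amulE (big_fset_incl _ s1) /=; last first.
  move=> x _ /mcoeff_outdom ->; rewrite big1 // => y _.
  by rewrite mul0r scale0r.
apply: eq_bigr => x _; apply: (big_fset_incl _ s2) => y _ /mcoeff_outdom ->.
by rewrite mulr0 scale0r.
Qed.

Lemma amul_linearl b : linear (amul^~ b).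
Proof.
move=> c a1 a2 /=; pose d := fsetU (msupp a1) (msupp a2).
have s1 : fsubset (msupp a1) d by apply: fsubsetUl.
have s2 : fsubset (msupp a2) d by apply: fsubsetUr.
have s3 : fsubset (msupp (c *: a1 + a2)) d.
  apply: (fsubset_trans (msuppD_le _ _)); apply: fsetUSS => //.
  exact: msuppZ_le.
have sb := fsubset_refl (msupp b).
rewrite (amulw s1 sb) (amulw s2 sb) (amulw s3 sb).
rewrite scaler_sumr -big_split; apply: eq_bigr => x _ /=.
rewrite scaler_sumr -big_split; apply: eq_bigr => y _ /=.
by rewrite mcoeffD mcoeffZ mulrDl scalerDl scalerA mulrA.
Qed.

Lemma amul_linearr a : linear (amul a).
Proof.
move=> c a1 a2 /=; pose d := fsetU (msupp a1) (msupp a2).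
have s1 : fsubset (msupp a1) d by apply: fsubsetUl.
have s2 : fsubset (msupp a2) d by apply: fsubsetUr.
have s3 : fsubset (msupp (c *: a1 + a2)) d.
  apply: (fsubset_trans (msuppD_le _ _)); apply: fsetUSS => //.
  exact: msuppZ_le.
have sb := fsubset_refl (msupp a).
rewrite (amulw sb s1) (amulw sb s2) (amulw sb s3).
rewrite scaler_sumr -big_split; apply: eq_bigr => x _ /=.
rewrite scaler_sumr -big_split; apply: eq_bigr => y _ /=.
by rewrite mcoeffD mcoeffZ mulrDr scalerDl scalerA mulrCA.
Qed.

HB.instance Definition _ a :=
  GRing.isLinear.Build k Aminus Aminus *:%R (amul a) (amul_linearr a).

Definition amulr (b a : Aminus) := amul a b.
HB.instance Definition _ b :=
  GRing.isLinear.Build k Aminus Aminus *:%R (amulr b) (amul_linearl b).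

Lemma alg_expand (a : Aminus) : a = \sum_(x <- msupp a) a@_x *: << x >>.
Proof.
rewrite {1}[a]monalgE; apply: eq_bigr => x _; apply/malgP => y.
by rewrite mcoeffZ !mcoeffU mulrnAr mulr1.
Qed.

Lemma amulUU x y : amul << x >> << y >> = bprod x y.
Proof.
rewrite (amulw msuppU_le msuppU_le) !big_seq_fset1 !mcoeffUU.
by rewrite mulr1 scale1r.
Qed.

Lemma amul0l b : amul 0 b = 0. Proof. exact: (linear0 (amulr b)). Qed.
Lemma amul0r a : amul a 0 = 0. Proof. exact: linear0. Qed.

Lemma alg_lin_eq (f g : Aminus -> Aminus) :
  linear f -> linear g -> (forall x, f << x >> = g << x >>) -> f =1 g.
Proof.
move=> lf lg fg a.
pose F : {linear Aminus -> Aminus} := HB.pack f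
  (GRing.isLinear.Build k Aminus Aminus *:%R f lf).
pose G : {linear Aminus -> Aminus} := HB.pack g
  (GRing.isLinear.Build k Aminus Aminus *:%R g lg).
rewrite [a]alg_expand -[f _]/(F _) -[g _]/(G _) !linear_sum.
by apply: eq_bigr => x _; rewrite !linearZZ /= fg.
Qed.

Lemma amulUA x y z :
  amul (amul << x >> << y >>) << z >> = amul << x >> (amul << y >> << z >>).
Proof.
apply: etrans (congr1 (amul^~ _) (amulUU x y)) _.
apply: etrans _ (esym (congr1 (amul _) (amulUU y z))).
rewrite /bprod; have := bmulA x y z.
case: (bmul x y) => [xy|] /=; case: (bmul y z) => [yz|] /= e.
- by apply: etrans (amulUU xy z) (etrans _ (esym (amulUU x yz))); rewrite /bprod e.
- by apply: etrans (amulUU xy z) (etrans _ (esym (amul0r _))); rewrite /bprod e.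
- by apply: etrans (amul0l _) (etrans _ (esym (amulUU x yz))); rewrite /bprod -e.
- by apply: etrans (amul0l _) (esym (amul0r _)).
Qed.

Lemma amulA a b c : amul (amul a b) c = amul a (amul b c).
Proof.
apply: (alg_lin_eq (f := fun a => amul (amul a b) c)
  (g := fun a => amul a (amul b c)) _ _ _ a) => {a} [t u v|t u v|x] /=.
- by rewrite !amul_linearl.
- exact: amul_linearl.
apply: (alg_lin_eq (f := fun b => amul (amul _ b) c)
  (g := fun b => amul _ (amul b c)) _ _ _ b) => {b} [t u v|t u v|y] /=.
- by rewrite amul_linearr amul_linearl.
- by rewrite amul_linearl amul_linearr.
apply: (alg_lin_eq (f := amul _)
  (g := fun c => amul _ (amul _ c)) _ _ _ c) => {c} [||z] /=.
- exact: amul_linearr.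
- move=> t u v; rewrite -amul_linearr; congr amul; exact: amul_linearr.
exact: amulUA.
Qed.

Lemma amul1U n x : amul (aone n) << x >> = if lpts x == n then << x >> else 0.
Proof.
rewrite amulUU /bprod; case: eqP => [<-|ne].
  have [m [l [y ->]]] := packP x.
  by rewrite bmul_pack dmul1d.
by rewrite bmul_neq //= => e; apply: ne.
Qed.

Lemma amulU1 n x : amul << x >> (aone n) = if rpts x == n then << x >> else 0.
Proof.
rewrite amulUU /bprod; case: eqP => [<-|ne].
  have [m [l [y ->]]] := packP x.
  by rewrite bmul_pack dmuld1.
by rewrite bmul_neq.
Qed.

Lemma alg_unital (a : Aminus) : exists N, a = \sum_(n < N) amul (aone n) a.
Proof.
exists (\max_(x <- msupp a) lpts x).+1.
set N := _.+1.
transitivity (\sum_(n < N) \sum_(x <- msupp a) amul (aone n) (a@_x *: << x >>));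
  last by apply: eq_bigr => n _; rewrite -linear_sum /= -alg_expand.
rewrite {1}[a]alg_expand exchange_big /= big_seq [RHS]big_seq.
apply: eq_bigr => x xa.
have lx : (lpts x < N)%N.
  by rewrite ltnS (@leq_bigmax_seq _ _ xpredT lpts).
rewrite (bigD1 (Ordinal lx)) //= big1 ?addr0.
  by rewrite linearZ /= amul1U eqxx.
move=> i /negbTE ne; rewrite linearZ /= amul1U ifF ?scaler0 //.
by apply/negbTE; apply: contraFN ne => /eqP e; apply/eqP/val_inj.
Qed.

(* Left A^- -modules M with M = \bigoplus_n 1_n M; the sum of the 1_n M is
   automatically direct since the 1_n are orthogonal idempotents. *)
Record amod := AMod {
  amod_sort :> lmodType k;
  act : Aminus -> amod_sort -> amod_sort;
  act_linearl : forall v, linear (act^~ v);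
  act_linearr : forall a, linear (act a);
  actM : forall a b v, act (amul a b) v = act a (act b v);
  act_unital : forall v, exists N, v = \sum_(n < N) act (aone n) v
}.

Lemma act0r (M : amod) a : act a (0 : M) = 0.
Proof.
have := act_linearr a (-1) (0 : M) 0.
by rewrite !scaleN1r oppr0 addr0 addNr.
Qed.

Lemma act0l (M : amod) (v : M) : act 0 v = 0.
Proof.
have := act_linearl v (-1) 0 0.
by rewrite !scaleN1r oppr0 addr0 addNr.
Qed.

Lemma act_sumr (M : amod) a n (F : 'I_n -> M) :
  act a (\sum_(i < n) F i) = \sum_(i < n) act a (F i).
Proof.
apply: (big_morph (act a) _ (act0r M a)) => u v.
by rewrite -{1}[u]scale1r act_linearr scale1r.
Qed.

Lemma act_unital_ge (M : amod) (v : M) :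
  exists n0, forall n, (n0 <= n)%N -> v = \sum_(i < n) act (aone i) v.
Proof.
have [n0 e0] := act_unital v; exists n0 => n le_n; rewrite {1}e0.
rewrite (big_ord_widen _ (fun i => act (aone i) v) le_n) big_mkcond /=.
apply: eq_bigr => i _; case: ltnP => // le_i.
rewrite e0 act_sumr big1 // => j _.
rewrite -actM amulU1 ifF ?act0l //.
by apply: gtn_eqF; apply: leq_trans le_i.
Qed.

Definition regular_amod : amod :=
  @AMod Aminus amul amul_linearl amul_linearr amulA alg_unital.

Definition amod_iso (M N : amod) : Prop :=
  exists f : {linear M -> N},
    bijective f /\ forall a v, f (act a v) = act a (f v).

Record submod (M : amod) := Submod {
  smem :> {pred M};
  smem_closed : submod_closed smem;
  smem_act : forall a v, v \in smem -> act a v \in smem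
}.

HB.instance Definition _ (M : amod) (N : submod M) :=
  GRing.isSubmodClosed.Build k M (smem N) (smem_closed N).

Section Sub.
Variables (M : amod) (N : submod M).

Definition sub_sort := {v : M | v \in smem N}.
HB.instance Definition _ := SubChoice.on sub_sort.
HB.instance Definition _ := [SubChoice_isSubLmodule of sub_sort by <:].

Definition sub_act (a : Aminus) (v : sub_sort) : sub_sort :=
  exist _ (act a (val v)) (smem_act a (valP v)).

Lemma sub_act_linearl v : linear (sub_act^~ v).
Proof.
by move=> c a b; apply: val_inj; rewrite /= act_linearl.
Qed.

Lemma sub_act_linearr a : linear (sub_act a).
Proof.
by move=> c u v; apply: val_inj; rewrite /= act_linearr.
Qed.

Lemma sub_actM a b v : sub_act (amul a b) v = sub_act a (sub_act b v).
Proof. by apply: val_inj; rewrite /= actM. Qed.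

Lemma sub_act_unital v : exists n, v = \sum_(i < n) sub_act (aone i) v.
Proof.
have [n e] := act_unital (val v); exists n; apply: val_inj.
by rewrite {1}e raddf_sum.
Qed.

Definition sub_amod : amod :=
  @AMod sub_sort sub_act sub_act_linearl sub_act_linearr sub_actM
    sub_act_unital.

End Sub.

Section Quot.
Variables (M : amod) (N : submod M).

Let I : zmodClosed M := smem N.
Definition quot_sort := Quotient.quot I.
HB.instance Definition _ := GRing.Zmodule.on quot_sort.
HB.instance Definition _ := EqQuotient.on quot_sort.

Definition quot_pi (v : M) : quot_sort := \pi_quot_sort%qT v.

Lemma quot_piP (u v : M) : reflect (quot_pi u = quot_pi v) (u - v \in smem N).
Proof. by rewrite -[_ \in _]/(u - v \in I) Quotient.idealrBE; apply: eqP. Qed.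

Lemma quot_piK (v : quot_sort) : quot_pi (repr v) = v.
Proof. exact: reprK. Qed.

Lemma quot_piD u v : quot_pi (u + v) = quot_pi u + quot_pi v.
Proof. exact: (raddfD \pi_(Quotient.quot I)%qT). Qed.

Definition quot_scale (c : k) (v : quot_sort) : quot_sort :=
  quot_pi (c *: repr v).

Definition quot_act (a : Aminus) (v : quot_sort) : quot_sort :=
  quot_pi (act a (repr v)).

Lemma quot_scaleE c v : quot_scale c (quot_pi v) = quot_pi (c *: v).
Proof.
apply/quot_piP; rewrite -scalerBr rpredZ //.
by apply/quot_piP; rewrite quot_piK.
Qed.

Lemma quot_actE a v : quot_act a (quot_pi v) = quot_pi (act a v).
Proof.
apply/quot_piP; have -> : act a (repr (quot_pi v)) - act a v
  = act a (repr (quot_pi v) - v).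
  by rewrite addrC -scaleN1r -act_linearr scaleN1r addrC.
by apply: smem_act; apply/quot_piP; rewrite quot_piK.
Qed.

Lemma quot_scaleA a b v : quot_scale a (quot_scale b v) = quot_scale (a * b) v.
Proof. by rewrite -[v]quot_piK !quot_scaleE scalerA. Qed.

Lemma quot_scale1 : left_id 1 quot_scale.
Proof. by move=> v; rewrite -[v]quot_piK quot_scaleE scale1r. Qed.

Lemma quot_scaleDr : right_distributive quot_scale +%R.
Proof.
move=> a u v; rewrite -[u]quot_piK -[v]quot_piK -quot_piD !quot_scaleE.
by rewrite scalerDr quot_piD.
Qed.

Lemma quot_scaleDl v : {morph quot_scale^~ v : a b / a + b}.
Proof.
by move=> a b; rewrite -[v]quot_piK !quot_scaleE scalerDl quot_piD.
Qed.

HB.instance Definition _ := GRing.Zmodule_isLmodule.Build k quot_sort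
  quot_scaleA quot_scale1 quot_scaleDr quot_scaleDl.

Lemma quot_piZ c v : quot_pi (c *: v) = c *: quot_pi v.
Proof. by rewrite -quot_scaleE. Qed.

Lemma quot_act_linearl v : linear (quot_act^~ v).
Proof.
move=> c a b /=; rewrite -[v]quot_piK !quot_actE act_linearl.
by rewrite quot_piD quot_piZ.
Qed.

Lemma quot_act_linearr a : linear (quot_act a).
Proof.
move=> c u v; rewrite -[u]quot_piK -[v]quot_piK -quot_piZ -quot_piD.
by rewrite !quot_actE act_linearr quot_piD quot_piZ.
Qed.

Lemma quot_actM a b v : quot_act (amul a b) v = quot_act a (quot_act b v).
Proof. by rewrite -[v]quot_piK !quot_actE actM. Qed.

Lemma quot_act_unital v : exists n, v = \sum_(i < n) quot_act (aone i) v.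
Proof.
have [n e] := act_unital (repr v); exists n.
rewrite -{1}[v]quot_piK e (big_morph quot_pi quot_piD (id1 := 0)).
  by apply: eq_bigr => i _; rewrite -quot_actE quot_piK.
exact: (raddf0 \pi_(Quotient.quot I)%qT).
Qed.

Definition quot_amod : amod :=
  @AMod quot_sort quot_act quot_act_linearl quot_act_linearr quot_actM
    quot_act_unital.

End Quot.

Section Copies.
Variables (c : nat) (M : amod).

Definition copies_act (a : Aminus) (v : {ffun 'I_c -> M}) : {ffun 'I_c -> M} :=
  [ffun i => act a (v i)].

Lemma copies_act_linearl v : linear (copies_act^~ v).
Proof. by move=> t a b; apply/ffunP => i; rewrite !ffunE act_linearl. Qed.

Lemma copies_act_linearr a : linear (copies_act a).
Proof. by move=> t u v; apply/ffunP => i; rewrite !ffunE act_linearr. Qed.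

Lemma copies_actM a b v : copies_act (amul a b) v = copies_act a (copies_act b v).
Proof. by apply/ffunP => i; rewrite !ffunE actM. Qed.

Lemma copies_act_unital v : exists n, v = \sum_(i < n) copies_act (aone i) v.
Proof.
have /choice[N hN] : forall i : 'I_c, exists n0, forall n, (n0 <= n)%N ->
    v i = \sum_(j < n) act (aone j) (v i).
  by move=> i; apply: act_unital_ge.
exists (\max_i N i)%N; apply/ffunP => i; rewrite sum_ffunE.
rewrite [LHS](hN i (\max_i N i)%N) ?leq_bigmax //.
by apply: eq_bigr => j _; rewrite ffunE.
Qed.

(* M ^ c, the direct sum of c copies of M *)
Definition copies : amod :=
  @AMod {ffun 'I_c -> M} copies_act copies_act_linearl copies_act_linearr
    copies_actM copies_act_unital.

End Copies.

(* N' viewed as a submodule of N; this is N' itself when N' is contained in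
   N. *)
Section Restrict.
Variables (M : amod) (N N' : submod M).

Definition restrict_mem : {pred sub_amod N} := fun v => sval v \in smem N'.

Lemma restrict_closed : submod_closed restrict_mem.
Proof.
split=> [|c u v hu hv]; first exact: (rpred0 (smem N')).
by rewrite unfold_in /=; apply: (rpredD (S := smem N')); rewrite ?rpredZ.
Qed.

Lemma restrict_act a v : v \in restrict_mem -> act a v \in restrict_mem.
Proof. by move=> hv; apply: (smem_act (s := N') a (v := sval v)). Qed.

Definition restrict_submod : submod (sub_amod N) :=
  Submod restrict_closed restrict_act.

End Restrict.

Definition has_dim (V : lmodType k) (S : set V) (d : nat) : Prop :=
  exists e : 'I_d -> V,
    [/\ forall i, S (e i),
        forall c : 'I_d -> k, \sum_i c i *: e i = 0 -> forall i, c i = 0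
      & forall v, S v -> exists c : 'I_d -> k, v = \sum_i c i *: e i].

(* 1_n M *)
Definition weight_space (M : amod) (n : nat) : set M :=
  fun v => exists w, v = act (aone n) w.

(* [M : L_n] := dim (1_n M) (and 0 if this dimension is infinite) *)
Definition simple_mult (M : amod) (n : nat) : nat :=
  xget 0%N (fun d => has_dim (@weight_space M n) d).

Section Projective.
Variable n : nat.

Definition proj_mem : {pred regular_amod} :=
  fun a => `[< exists b, a = amul b (aone n) >].

Lemma proj_closed : submod_closed proj_mem.
Proof.
split=> [|c u v /asboolP[b ->] /asboolP[b' ->]]; apply/asboolP.
  by exists 0; rewrite amul0l.
by exists (c *: b + b'); rewrite amul_linearl.
Qed.

Lemma proj_act a v : v \in proj_mem -> act a v \in proj_mem.
Proof.
by move=> /asboolP[b ->]; apply/asboolP; exists (amul a b); rewrite amulA.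
Qed.

(* P_n = A^- 1_n *)
Definition proj : amod := sub_amod (Submod proj_closed proj_act).

(* The span in P_n of a set D of diagrams: an element of A^- is a combination
   of diagrams in D exactly when its support is contained in D. The right endpoint count need
   not be imposed: elements of P_n only involve diagrams with n right points. *)
Section Span.
Variable D : pred bdiag.
Hypothesis D_bmul : forall x y z, bmul x y = Some z -> D y -> D z.

Definition span_mem : {pred proj} := fun v => all D (msupp (sval v : Aminus)).

Lemma span_closed : submod_closed span_mem.
Proof.
split=> [|c u v /allP hu /allP hv]; apply/allP => x /=.
  by rewrite msupp0 inE.
move=> /(fsubsetP (msuppD_le _ _)); rewrite inE => /orP[|/hv//].
by move=> /(fsubsetP (msuppZ_le _ _)) /hu.
Qed.

Lemma span_act a v : v \in span_mem -> act a v \in span_mem.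
Proof.
move=> /allP hv; apply/allP => z /=; rewrite -mcoeff_neq0 => nz.
apply/negPn/negP => nDz; case/eqP: nz; rewrite amulE raddf_sum big1 // => x _.
rewrite raddf_sum big_seq big1 // => y /hv Dy /=.
rewrite mcoeffZ /bprod; case e: bmul => [z'|]; last by rewrite mcoeff0 mulr0.
rewrite mcoeffU; case: eqP => [ez|_]; last by rewrite mulr0.
by case/negP: nDz; rewrite -ez; apply: D_bmul e Dy.
Qed.

Definition diag_span : submod proj := Submod span_closed span_act.

End Span.

(* P_n(<= m), for m >= -1 *)
Definition P_le (m : int) : submod proj :=
  @diag_span (fun x => (width x)%:Z <= m)
    (fun x y z e hy => le_trans (bmul_width e : (width z)%:Z <= width y) hy).

(* P_n(<= m) / P_n(<= m - 1) *)
Definition P_layer (m : nat) : amod :=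
  quot_amod (restrict_submod (P_le m) (P_le (m%:Z - 1))).

(* M_n *)
Definition standard : amod := quot_amod (diag_span bmul_rsarc).

End Projective.

(* [P_n : M_m], the number of copies of M_m in P_n(<= m) / P_n(<= m - 1) *)
Definition standard_mult (n m : nat) : nat :=
  if (m <= n)%N then
    xget 0%N (fun c => amod_iso (P_layer n m) (copies c (standard m)))
  else 0%N.

End Algebra.

(* Main.v *)
Require Import Defs.
From HB Require Import structures.
From mathcomp Require Import mathcomp_extra boolp classical_sets.
From mathcomp Require Import all_boot all_order all_algebra finmap.
From mathcomp Require Import monalg.

Set Implicit Arguments.
Unset Strict Implicit.
Unset Printing Implicit Defensive.

Import Order.TTheory GRing.Theory Num.Theory.
Local Open Scope ring_scope.

(* Write d_J for the diagram from m to n points without left sarcs whose larcs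
   end at J.  Right multiplication by d_J never creates floating arcs and
   preserves left endpoints of larcs, so it embeds P_m into P_n(<= m) and maps
   exactly the diagrams with a right sarc to width < m.  Since every diagram of
   width m in P_n is uniquely of the form x d_J with x free of right sarcs, the
   map (v_J) |-> sum_J v_J d_J induces an isomorphism from the direct sum of
   copies of M_m indexed by the m-subsets J onto the m-th layer.  The number of
   copies is unique because 1_m M_m is a line. *)

(** * Invariance of dimension *)

Section Dimension.
Variable k : fieldType.

(** Expanding each family in the other gives matrices whose product is the identity of size [d]; as
    it factors through size [d'], the inequality follows by rank. *)
Lemma has_dim_leq (V : lmodType k) (S : set V) d d' :
  has_dim S d -> has_dim S d' -> (d <= d')%N.
Proof.
case=> e [eS e_free e_gen] [e' [e'S _ e'_gen]].
have /choice[a aE] i := e'_gen _ (eS i).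
have /choice[b bE] j := e_gen _ (e'S j).
suff /mulmx1_min : (\matrix_(i, j) a i j) *m (\matrix_(j, i) b j i) = 1%:M :> 'M_d.
  by [].
apply/matrixP => i l; apply/eqP; rewrite -subr_eq0; apply/eqP; move: l.
(* Row [i] of the product minus the identity is the coefficient vector of a combination of the
   [e l]; freeness reduces the claim to the vanishing of that combination. *)
apply: e_free.
under eq_bigr do rewrite scalerBl.
rewrite sumrB (bigD1 (P := xpredT) (F := fun l => 1%:M i l *: e l) i) //=.
rewrite [X in _ - (_ + X)]big1 => [|l ne]; last first.
  by rewrite mxE eq_sym (negbTE ne) scale0r.
rewrite mxE eqxx scale1r addr0; apply/eqP; rewrite subr_eq0; apply/eqP.
rewrite [RHS]aE; under [RHS]eq_bigr do rewrite bE scaler_sumr.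
rewrite exchange_big /=; apply: eq_bigr => l _.
rewrite mxE scaler_suml; apply: eq_bigr => j _.
by rewrite !mxE scalerA.
Qed.

Lemma has_dim_unique (V : lmodType k) (S : set V) d d' :
  has_dim S d -> has_dim S d' -> d = d'.
Proof.
by move=> h h'; apply/eqP; rewrite eqn_leq (has_dim_leq h h') (has_dim_leq h' h).
Qed.

End Dimension.

(** * Weight spaces under isomorphisms and direct sums; quotient maps *)

Section Modules.
Variable k : fieldType.
Implicit Types M N : amod k.

Lemma amod_iso_sym M N : amod_iso M N -> amod_iso N M.
Proof.
case=> f [[g fK gK] f_act].
have lg : linear g := can2_linear fK gK.
pose G : {linear N -> M} := HB.pack g
  (GRing.isLinear.Build k N M *:%R g lg).
exists G; split; first by exists f.
by move=> a v; apply: (can_inj fK); rewrite f_act !gK.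
Qed.

Lemma has_dim_iso M N n d : amod_iso M N ->
  has_dim (@weight_space k M n) d -> has_dim (@weight_space k N n) d.
Proof.
case=> f [[g fK gK] f_act] [e [eW e_free e_gen]].
exists (fun i => f (e i)); split.
- by move=> i; have [w ->] := eW i; exists (f w); rewrite f_act.
- move=> c; under eq_bigr do rewrite -linearZ.
  rewrite -linear_sum -[RHS](linear0 f) => /(can_inj fK); exact: e_free.
- move=> _ [w ->]; have [|c cE] := e_gen (act (aone k n) (g w)).
    by exists (g w).
  exists c; rewrite -{1}[w]gK -f_act cE linear_sum.
  by apply: eq_bigr => i _; rewrite linearZ.
Qed.

Lemma has_dim_copies c M n :
  has_dim (@weight_space k M n) 1 ->
  has_dim (@weight_space k (copies c M) n) c.
Proof.
case=> e [eW e_free e_gen].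
pose E (i : 'I_c) : copies c M := [ffun j => if j == i then e ord0 else 0].
have EE (a : 'I_c -> k) j : (\sum_i a i *: E i) j = a j *: e ord0.
  rewrite sum_ffunE (bigD1 j) //= big1 ?addr0; last first.
    by move=> i ne; rewrite !ffunE eq_sym (negbTE ne) scaler0.
  by rewrite !ffunE eqxx.
exists E; split.
- move=> i; have [w ew] := eW ord0.
  exists [ffun j => if j == i then w else 0]; apply/ffunP => j.
  by rewrite !ffunE; case: eqP => // _; rewrite act0r.
- move=> a aE i.
  apply: (e_free (fun=> a i) _ ord0); rewrite big_ord1 -EE aE.
  by rewrite ffunE.
- move=> _ [w ->].
  have /choice[a aE] (i : 'I_c) : exists a, act (aone k n) (w i) = a *: e ord0.
    have [|a ->] := e_gen (act (aone k n) (w i)); first by exists (w i).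
    by exists (a ord0); rewrite big_ord1.
  by exists a; apply/ffunP => j; rewrite EE -aE ffunE.
Qed.

(** When [1_n M] is a line, the dimension of [1_n L] counts the copies. *)
Lemma amod_iso_copies_inj L M n c c' : has_dim (@weight_space k M n) 1 ->
  amod_iso L (copies c M) -> amod_iso L (copies c' M) -> c = c'.
Proof.
move=> dM /amod_iso_sym iso /amod_iso_sym iso'.
apply: has_dim_unique (has_dim_iso iso (has_dim_copies c dM)) _.
exact: has_dim_iso iso' (has_dim_copies c' dM).
Qed.

Lemma quot_pi0 M (N : submod M) (v : M) : reflect (quot_pi N v = 0) (v \in smem N).
Proof.
have -> : (0 : quot_sort N) = quot_pi N 0.
  by apply: (addrI (quot_pi N 0)); rewrite -quot_piD !addr0.
by have := quot_piP N v 0; rewrite subr0.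
Qed.

Lemma quot_pi_sum M (N : submod M) (I : Type) (r : seq I) (P : pred I) (F : I -> M) :
  quot_pi N (\sum_(i <- r | P i) F i) = \sum_(i <- r | P i) quot_pi N (F i).
Proof.
apply: (big_morph (quot_pi N)); first exact: quot_piD.
by apply/quot_pi0; apply: (rpred0 (smem N)).
Qed.

End Modules.

(** * Subsets of size [m] and factorization of diagrams through [m] points *)

Section Draws.
Variables n m : nat.

Definition draw := {J : {set 'I_n} | #|J| == m}.

Lemma card_draw : #|{: draw}| = 'C(n, m).
Proof. by rewrite card_sig -cardsE card_draws card_ord. Qed.

Lemma rfull_subproof (I : draw) :
  #|(val I, [set: 'I_m]).1| == #|(val I, [set: 'I_m]).2|.
Proof. by rewrite /= cardsT card_ord; apply: (valP I). Qed.

Definition rfull (I : draw) : diag n m :=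
  exist _ (val I, [set: 'I_m]) (rfull_subproof I).

Lemma lfull_subproof (J : draw) :
  #|([set: 'I_m], val J).1| == #|([set: 'I_m], val J).2|.
Proof. by rewrite /= cardsT card_ord eq_sym; apply: (valP J). Qed.

Definition lfull (J : draw) : diag m n :=
  exist _ ([set: 'I_m], val J) (lfull_subproof J).

End Draws.

Section Diagrams.

Lemma pack_inj m n : injective (@pack m n).
Proof. by move=> y z; rewrite /pack => /eqP; rewrite eq_Tagged => /eqP. Qed.

Lemma width_rpts x : (width x <= rpts x)%N.
Proof.
have [m [n [y ->]]] := packP x; rewrite /width /rpts /= /dwidth card_lrset.
by rewrite -[X in (_ <= X)%N]card_ord max_card.
Qed.

(** The width also counts the right endpoints of larcs, so a deficit means that some right point
    carries a sarc. *)
Lemma has_rsarcE x : has_rsarc x = (width x < rpts x)%N.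
Proof.
have [m [n [y ->]]] := packP x; rewrite /width /rpts /= /dwidth card_lrset.
by rewrite /has_rsarc /= eqEcard subsetT cardsT card_ord /= -ltnNge.
Qed.

Lemma no_rsarcP x n : rpts x = n ->
  ~~ has_rsarc x <-> exists I : draw (lpts x) n, x = pack (rfull I).
Proof.
have [m [n' [y ->]]] := packP x; rewrite /rpts /lpts /= => en; subst n'.
split=> [|[I /pack_inj ->]]; last by rewrite /has_rsarc /= eqxx.
rewrite /has_rsarc negbK => /eqP /= yT.
have hy : #|lset y| == n by rewrite card_lrset yT cardsT card_ord.
by exists (exist _ (lset y) hy); congr pack; apply: diag_eq.
Qed.

Lemma bmul_rpts x y z :
  bmul x y = Some z -> [/\ rpts x = lpts y, lpts z = lpts x & rpts z = rpts y].
Proof.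
have [m [n [{}x ->]]] := packP x; have [n' [l [{}y ->]]] := packP y.
have [en|nn] := eqVneq n n'; last by rewrite bmul_pack_neq.
by subst n'; rewrite bmul_pack; case: dmul => //= d [<-].
Qed.

Lemma dmul_lfull p n m (y : diag p m) (J : draw n m) :
  dmul y (lfull J) = Some (dcat y (lfull J)).
Proof. by rewrite /dmul ifF //; apply/negbTE/floatingPn => j _; rewrite inE. Qed.

Lemma lset_dcat_lfull p n m (y : diag p m) (J : draw n m) :
  lset (dcat y (lfull J)) = lset y.
Proof.
apply/setP => i; rewrite inE; apply/existsP/idP => [[j /andP[_ /larc_lset //]]|].
by move=> /larc_l[j yij]; exists j; rewrite yij inE.
Qed.

Lemma bmul_lfull_width x n m (J : draw n m) z :
  bmul x (pack (lfull J)) = Some z -> width z = width x.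
Proof.
have [p [m' [y ->]]] := packP x;
have [e|ne] := eqVneq m' m; last by rewrite bmul_pack_neq.
subst m'; rewrite bmul_pack dmul_lfull => -[<-].
by rewrite /width /= /dwidth lset_dcat_lfull.
Qed.

(** Larcs of the product end in [J]; there are [m] of them, so they exhaust [J]. *)
Lemma rset_dcat_lfull p n m (I : draw p m) (J : draw n m) :
  rset (dcat (rfull I) (lfull J)) = val J.
Proof.
apply/eqP; rewrite eqEcard (rset_dcat _ (lfull J)) /= -card_lrset lset_dcat_lfull.
by rewrite (eqP (valP I)) (eqP (valP J)).
Qed.

(** Uniqueness of the factorization: [I] and [J] are recovered as the endpoint sets of the
    product. *)
Lemma bmul_lfull_inj x n m p (I : draw p m) (J J' : draw n m) :
  bmul x (pack (lfull J')) = Some (pack (dcat (rfull I) (lfull J))) ->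
  x = pack (rfull I) /\ J' = J.
Proof.
have [p' [m' [y ->]]] := packP x;
have [e|ne] := eqVneq m' m; last by rewrite bmul_pack_neq.
subst m'; rewrite bmul_pack dmul_lfull => /Some_inj e.
have ep : p' = p by apply: (congr1 lpts e).
subst p'; have {}e := pack_inj e.
have hy : y = rfull I.
  have lI : lset y = val I by rewrite -(lset_dcat_lfull y J') e lset_dcat_lfull.
  (* The width of [y] is the size [m] of [I], so all [m] right points of [y] carry larcs. *)
  apply: diag_eq => //; apply/eqP.
  by rewrite eqEcard subsetT -(card_lrset y) lI cardsT card_ord (eqP (valP I)) leqnn.
split; first by rewrite hy.
by apply: val_inj; rewrite -(rset_dcat_lfull I) -hy e rset_dcat_lfull.
Qed.

Lemma width_eqP x n m : rpts x = n -> width x = m ->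
  exists (I : draw (lpts x) m) (J : draw n m), x = pack (dcat (rfull I) (lfull J)).
Proof.
have [p [n' [y ->]]] := packP x; rewrite /rpts /lpts /width /= => en; subst n'.
move=> wy; have hI : #|lset y| == m by apply/eqP.
have hJ : #|rset y| == m by rewrite -card_lrset.
exists (exist _ (lset y) hI), (exist _ (rset y) hJ); congr pack; apply: diag_eq.
  by rewrite lset_dcat_lfull.
by rewrite rset_dcat_lfull.
Qed.

End Diagrams.

(** * Comparison of two quotients of one module *)

Section Isomorphism.
Variable k : fieldType.

(* Both modules are quotients of [K] by the same submodule. *)
Lemma amod_iso_epi (K M N : amod k) (f : K -> M) (g : K -> N) :
  linear f -> linear g ->
  (forall a v, f (act a v) = act a (f v)) ->
  (forall a v, g (act a v) = act a (g v)) ->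
  (forall x, exists v, f v = x) -> (forall y, exists v, g v = y) ->
  (forall v, f v = 0 <-> g v = 0) -> amod_iso M N.
Proof.
move=> lf lg f_act g_act f_surj g_surj ker_fg.
pose F : {linear K -> M} := HB.pack f (GRing.isLinear.Build k K M *:%R f lf).
pose G : {linear K -> N} := HB.pack g (GRing.isLinear.Build k K N *:%R g lg).
have fg u v : f u = f v <-> g u = g v.
  have fB : f (u - v) = f u - f v by apply: (linearB F).
  have gB : g (u - v) = g u - g v by apply: (linearB G).
  split=> e; apply/eqP; rewrite -subr_eq0 -?fB -?gB; apply/eqP/ker_fg.
    by rewrite fB e subrr.
  by rewrite gB e subrr.
have /choice[s sK] := f_surj; have /choice[t tK] := g_surj.
(* By [fg], the value of [h] does not depend on the chosen preimage; linearity and equivariance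
   follow from this. *)
pose h x := g (s x).
have lh : linear h.
  by move=> c x y; rewrite /h -lg; apply/fg; rewrite lf !sK.
exists (HB.pack h (GRing.isLinear.Build k M N *:%R h lh) : {linear M -> N}).
split=> [|a x] /=.
  exists (fun y => f (t y)) => [x|y]; rewrite /h.
    by rewrite -[RHS]sK; apply/fg; rewrite tK.
  by rewrite -[RHS]tK; apply/fg; rewrite sK.
by rewrite /h -g_act; apply/fg; rewrite f_act !sK.
Qed.

End Isomorphism.

(** * Coefficients of products *)

Section Coefficients.
Variable k : fieldType.
Implicit Types (a : Aminus k) (x y z : bdiag).

(** The flag [c] records a side condition independent of [x], such as equality of two subsets or of
    two numbers of endpoints. *)
Lemma mcoeff_sumU a z (c : bool) :
  \sum_(x <- msupp a) a@_x * ((x == z) && c)%:R = if c then a@_z else 0.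
Proof.
case: c; last by rewrite big1 // => x _; rewrite andbF mulr0.
under eq_bigr do rewrite andbT.
have [za|za] := boolP (z \in msupp a).
  rewrite (bigD1_seq z) ?fset_uniq //= eqxx mulr1 big1 ?addr0 // => x.
  by move=> /negbTE->; rewrite mulr0.
rewrite (mcoeff_outdom za) big_seq big1 // => x xa.
by case: eqP za => [<-|_]; rewrite ?xa ?mulr0.
Qed.

Lemma mcoeff_amulU a y z :
  (amul a << y >>)@_z = \sum_(x <- msupp a) a@_x * (bprod k x y)@_z.
Proof.
rewrite (amulw (fsubset_refl _) msuppU_le) raddf_sum; apply: eq_bigr => x _ /=.
by rewrite big_seq_fset1 mcoeffUU mulr1 mcoeffZ.
Qed.

Lemma mcoeffU_neq0 x y : (<< x >> : Aminus k)@_y != 0 -> x = y.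
Proof. by rewrite mcoeffU; have [//|_] := eqVneq x y; rewrite eqxx. Qed.

Lemma mcoeff_amulU_neq0 a y z : (amul a << y >>)@_z != 0 ->
  exists2 x, a@_x != 0 & bmul x y = Some z.
Proof.
rewrite mcoeff_amulU => nz; apply: contrapT => h; case/eqP: nz.
rewrite big_seq big1 // => x; rewrite -mcoeff_neq0 /bprod => xa.
case e: bmul => [z'|]; last by rewrite mcoeff0 mulr0.
rewrite mcoeffU; case: eqP => [ez|_]; last by rewrite mulr0.
by case: h; exists x => //; rewrite e ez.
Qed.

(** By unique factorization, only the term [x = pack (rfull I)] can contribute, and only if
    [J' = J]. *)
Lemma mcoeff_amul_lfull a n m p (I : draw p m) (J J' : draw n m) :
  (amul a << pack (lfull J') >>)@_(pack (dcat (rfull I) (lfull J)))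
    = if J' == J then a@_(pack (rfull I)) else 0.
Proof.
rewrite mcoeff_amulU -(mcoeff_sumU a (pack (rfull I))); apply: eq_bigr => x _.
congr (_ * _); case: (boolP (_ && _)) => [/andP[/eqP-> /eqP->]|ne].
  by rewrite /bprod bmul_pack dmul_lfull /= mcoeffUU.
rewrite /bprod; case e: bmul => [z|]; last by rewrite mcoeff0.
rewrite mcoeffU; case: eqP => // ez; rewrite ez in e.
by have [ex eJ] := bmul_lfull_inj e; rewrite ex eJ !eqxx in ne.
Qed.

Lemma mcoeff_amul1l a n z : (amul (aone k n) a)@_z = if lpts z == n then a@_z else 0.
Proof.
rewrite (amulw msuppU_le (fsubset_refl _)) big_seq_fset1 raddf_sum.
rewrite -(mcoeff_sumU a z); apply: eq_bigr => x _ /=.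
rewrite mcoeffZ mcoeffUU mul1r -amulUU amul1U; congr (_ * _).
have [->|ne] /= := eqVneq x z; first by case: ifP => _; rewrite ?mcoeffUU ?mcoeff0.
by case: ifP => _; rewrite ?mcoeffU ?mcoeff0 ?(negbTE ne).
Qed.

(** If all diagrams of [a] have [n] right points, then [a] equals its own product with
    [aone k n]. *)
Lemma proj_memP n a :
  a \in proj_mem n <-> forall x, a@_x != 0 -> rpts x = n.
Proof.
split=> [/asboolP[b ->] x|h].
  by move/mcoeff_amulU_neq0 => [y _ /bmul_rpts[_ _ ->]].
apply/asboolP; exists a; apply/malgP => z.
rewrite mcoeff_amulU; apply: etrans (esym (mcoeff_sumU a z true)) _.
rewrite !big_seq; apply: eq_bigr => x; rewrite -mcoeff_neq0 => /h rx.
by rewrite -amulUU amulU1 rx eqxx mcoeffU andbT.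
Qed.

End Coefficients.

Lemma val_sub_sum (k : fieldType) (M : amod k) (N : submod M) (I : Type) (r : seq I)
    (P : pred I) (F : I -> sub_amod N) :
  sval (\sum_(i <- r | P i) F i) = \sum_(i <- r | P i) (sval (F i) : M).
Proof. exact: (big_morph (fun v : sub_amod N => sval v : M)). Qed.

Lemma proj_rpts (k : fieldType) n (v : Defs.proj k n) x :
  (val v : Aminus k)@_x != 0 -> rpts x = n.
Proof. by move: x; apply/proj_memP; apply: (svalP v). Qed.

(** * The layers of the filtration of P_n *)

Section Layers.
Variables (k : fieldType) (n m : nat).

Local Notation layer_submod :=
  (restrict_submod (P_le k n m) (P_le k n (m%:Z - 1))).

Lemma span_memP p (D : pred bdiag) (v : Defs.proj k p) :
  v \in span_mem D <-> forall x, (val v : Aminus k)@_x != 0 -> D x.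
Proof.
split=> [/allP h x|h]; first by rewrite mcoeff_neq0; apply: h.
by apply/allP => x; rewrite -mcoeff_neq0; apply: h.
Qed.

(** Two nested subtypes are removed: P_n(<= m) inside P_n, and P_n inside the algebra. *)
Definition P_le_val (v : sub_amod (P_le k n m)) : Aminus k := val (val v).

(** The strict inequality in [nat] also covers [m = 0], where the integer bound is -1. *)
Lemma mem_layer (v : sub_amod (P_le k n m)) :
  v \in smem layer_submod <->
  forall x, (P_le_val v)@_x != 0 -> (width x < m)%N.
Proof.
rewrite -[v \in _]/(val v \in span_mem (fun x => (width x)%:Z <= m%:Z - 1)).
by rewrite span_memP; split=> h x /h; rewrite lerBrDr lezD1 ltz_nat.
Qed.

Section Insertion.
Variable J : draw n m.

Lemma amul_lfull_proj (v : Defs.proj k m) :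
  amul (val v) << pack (lfull J) >> \in @proj_mem k n.
Proof.
by apply/proj_memP => x /mcoeff_amulU_neq0[y _ /bmul_rpts[_ _ ->]].
Qed.

Definition rmul_proj (v : Defs.proj k m) : Defs.proj k n :=
  exist _ (amul (val v) << pack (lfull J) >>) (amul_lfull_proj v).

(** A product is at most as wide as its right factor, here d_J of width [m]. *)
Lemma amul_lfull_P_le (v : Defs.proj k m) : rmul_proj v \in smem (P_le k n m).
Proof.
apply/span_memP => x /mcoeff_amulU_neq0[y _ /bmul_width wx].
by rewrite lez_nat (leq_trans wx) // /width /= /dwidth cardsT card_ord.
Qed.

Definition rmul_P_le (v : Defs.proj k m) : sub_amod (P_le k n m) :=
  exist _ (rmul_proj v) (amul_lfull_P_le v).

Lemma rmul_P_le_linear : linear rmul_P_le.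
Proof. by move=> c u v; do 2!apply: val_inj => /=; rewrite -amul_linearl. Qed.

Lemma rmul_P_le_act a v : rmul_P_le (act a v) = act a (rmul_P_le v).
Proof. by do 2!apply: val_inj => /=; rewrite amulA. Qed.

End Insertion.

Local Notation ndraws := #|{: draw n m}|.

(** The map (v_J) |-> sum_J v_J d_J; since [copies] is indexed by ordinals, [enum_val] supplies the
    subset J. *)
Definition sum_rmul (v : copies ndraws (Defs.proj k m)) : sub_amod (P_le k n m) :=
  \sum_i rmul_P_le (enum_val i) (v i).

Lemma sum_rmul_linear : linear sum_rmul.
Proof.
move=> t u v; rewrite /sum_rmul scaler_sumr -big_split; apply: eq_bigr => i _.
by rewrite !ffunE /= rmul_P_le_linear.
Qed.

Lemma sum_rmul_act a v : sum_rmul (act a v) = act a (sum_rmul v).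
Proof.
by rewrite /sum_rmul act_sumr; apply: eq_bigr => i _; rewrite ffunE rmul_P_le_act.
Qed.

Lemma val_sum_rmul v :
  P_le_val (sum_rmul v) =
    \sum_i amul (val (v i)) << pack (lfull (enum_val i)) >>.
Proof.
rewrite /P_le_val -[val (sum_rmul v)]/(sval (sum_rmul v)) /sum_rmul val_sub_sum.
exact: (val_sub_sum _ _ (fun i => rmul_proj (enum_val i) (v i))).
Qed.

Lemma mcoeff_sum_rmul v p (I : draw p m) i :
  (P_le_val (sum_rmul v))@_(pack (dcat (rfull I) (lfull (enum_val i))))
    = (val (v i) : Aminus k)@_(pack (rfull I)).
Proof.
rewrite val_sum_rmul raddf_sum.
transitivity (\sum_j if j == i then (val (v j) : Aminus k)@_(pack (rfull I)) else 0).
  apply: eq_bigr => j _; rewrite -(inj_eq enum_val_inj); exact: mcoeff_amul_lfull.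
by rewrite -big_mkcond big_pred1_eq.
Qed.

(** A diagram of [v i] without right sarcs reappears, with the same coefficient, as a diagram of
    width [m]. Conversely, a right sarc forces width below [m], and multiplication by d_J preserves
    width. *)
Lemma sum_rmul_layer v :
  sum_rmul v \in smem layer_submod <->
  forall i, v i \in smem (diag_span k m bmul_rsarc).
Proof.
split=> [/mem_layer h i|h].
  apply/span_memP => x xv; case: (boolP (has_rsarc x)) => // nx; exfalso.
  have ex : rpts x = m by exact: proj_rpts xv.
  have [I eI] := (no_rsarcP ex).1 nx.
  have := h (pack (dcat (rfull I) (lfull (enum_val i)))).
  rewrite mcoeff_sum_rmul -eI => /(_ xv).
  by rewrite /width /= /dwidth lset_dcat_lfull (eqP (valP I)) ltnn.
apply: rpred_sum => i _; apply/mem_layer => z /mcoeff_amulU_neq0[x xv e].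
have [ex _ _] := bmul_rpts e.
have /span_memP/(_ x xv) := h i.
by rewrite has_rsarcE ex (bmul_lfull_width e).
Qed.

Lemma sum_rmul_surj (w : sub_amod (P_le k n m)) :
  exists v, w - sum_rmul v \in smem layer_submod.
Proof.
(* Stating the claim for elements of the whole algebra allows linear induction from single diagrams
   without carrying membership proofs. *)
pose Q (b : Aminus k) := exists v, forall z,
  (b - P_le_val (sum_rmul v))@_z != 0 -> (width z < m)%N.
suff [v hv] : Q (P_le_val w) by exists v; apply/mem_layer.
have sum_rmul0 : P_le_val (sum_rmul 0) = 0.
  by rewrite val_sum_rmul big1 // => i _; rewrite ffunE amul0l.
have Q0 : Q 0 by exists 0 => z; rewrite sum_rmul0 subr0 mcoeff0 eqxx.
have QD t b b' : Q b -> Q b' -> Q (t *: b + b').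
  case=> v hv [v' hv']; exists (t *: v + v') => z; rewrite sum_rmul_linear.
  have -> : P_le_val (t *: sum_rmul v + sum_rmul v')
    = t *: P_le_val (sum_rmul v) + P_le_val (sum_rmul v') by [].
  rewrite opprD addrACA -scalerBr mcoeffD mcoeffZ.
  have [/eqP e|/hv //] := boolP ((b - P_le_val (sum_rmul v))@_z == 0).
  by rewrite e mulr0 add0r => /hv'.
have QU x : rpts x = n -> (width x <= m)%N -> Q << x >>.
  move=> rx; rewrite leq_eqVlt => /predU1P[wx|wx]; last first.
    (* Diagrams of width below [m] already vanish in the layer, so the preimage 0 works. *)
    by exists 0 => z; rewrite sum_rmul0 subr0 => /mcoeffU_neq0 <-.
  (* At width exactly [m], the preimage is [rfull I] placed in the copy indexed by [J]. *)
  have [I [J eIJ]] := width_eqP rx wx.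
  have hI : << pack (rfull I) >> \in @proj_mem k m.
    by apply/proj_memP => y /mcoeffU_neq0 <-.
  pose u : Defs.proj k m := exist _ << pack (rfull I) >> hI.
  exists [ffun i => if i == enum_rank J then u else 0] => z.
  rewrite val_sum_rmul (bigD1 (enum_rank J)) //= big1 ?addr0; last first.
    by move=> i ne; rewrite ffunE (negbTE ne) amul0l.
  rewrite ffunE eqxx enum_rankK amulUU /bprod bmul_pack dmul_lfull /= -eIJ.
  by rewrite subrr mcoeff0 eqxx.
rewrite [P_le_val w]alg_expand big_seq.
apply: (big_ind Q) => // [b b' hb hb'|x].
  by rewrite -[b]scale1r; apply: QD.
rewrite -mcoeff_neq0 => xw; rewrite -[_ *: _]addr0; apply: QD => //.
apply: QU; first exact: proj_rpts xw.
by move: x xw; apply/span_memP; apply: (svalP w).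
Qed.

(** Copies of P_m surject onto both sides, and both kernels consist of the tuples whose components
    are spanned by diagrams with a right sarc. *)
Lemma P_layer_iso : amod_iso (P_layer k n m) (copies ndraws (standard k m)).
Proof.
pose f v : P_layer k n m := quot_pi layer_submod (sum_rmul v).
pose g (v : copies ndraws (Defs.proj k m)) : copies ndraws (standard k m) :=
  [ffun i => quot_pi (diag_span k m bmul_rsarc) (v i)].
apply: (@amod_iso_epi k _ _ _ f g).
- by move=> t u v; rewrite /f sum_rmul_linear quot_piD quot_piZ.
- by move=> t u v; apply/ffunP => i; rewrite !ffunE quot_piD quot_piZ.
- by move=> a v; rewrite /f sum_rmul_act -quot_actE.
- by move=> a v; apply/ffunP => i; rewrite !ffunE -quot_actE.
- move=> x; have [v hv] := sum_rmul_surj (repr x).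
  by exists v; rewrite -[x]quot_piK; apply/esym/quot_piP.
- move=> y; exists [ffun i => repr (y i)]; apply/ffunP => i.
  by rewrite !ffunE quot_piK.
move=> v; split=> [/quot_pi0/sum_rmul_layer h|h].
  by apply/ffunP => i; rewrite !ffunE; apply/quot_pi0.
apply/quot_pi0/sum_rmul_layer => i; apply/quot_pi0.
by have /ffunP/(_ i) := h; rewrite !ffunE.
Qed.

End Layers.

(** * Weight spaces of standard modules *)

Section Standard.
Variables (k : fieldType) (n m : nat).

(** A basis is given by the classes of the diagrams [rfull I], with [I] running over the [m]-subsets
    of the [n] left points. *)
Lemma has_dim_standard :
  has_dim (@weight_space k (standard k m) n) 'C(n, m).
Proof.
rewrite -card_draw.
have hI (I : draw n m) : << pack (rfull I) >> \in @proj_mem k m.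
  by apply/proj_memP => y /mcoeffU_neq0 <-.
pose E (i : 'I_#|{: draw n m}|) : Defs.proj k m :=
  exist _ << pack (rfull (enum_val i)) >> (hI (enum_val i)).
have valE (c : 'I_#|{: draw n m}| -> k) :
    val (\sum_i c i *: E i) = \sum_i c i *: << pack (rfull (enum_val i)) >> :> Aminus k.
  exact: (val_sub_sum _ _ (fun i => c i *: E i)).
have coefE (c : 'I_#|{: draw n m}| -> k) z :
    (val (\sum_i c i *: E i) : Aminus k)@_z
      = \sum_i c i * (pack (rfull (enum_val i)) == z)%:R.
  apply: etrans (congr1 (mcoeff z) (valE c)) _.
  by rewrite raddf_sum; apply: eq_bigr => i _; rewrite /= mcoeffZ mcoeffU.
have coefE1 (c : 'I_#|{: draw n m}| -> k) i :
    (val (\sum_i c i *: E i) : Aminus k)@_(pack (rfull (enum_val i))) = c i.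
  apply: etrans (coefE c _) _.
  rewrite (bigD1 i) //= eqxx mulr1 big1 ?addr0 // => j ne.
  case: eqP => [/pack_inj e|]; last by rewrite mulr0.
  case/eqP: ne; apply/enum_val_inj/val_inj; exact: (congr1 (@lset _ _) e).
have quotE c : \sum_i c i *: quot_pi (diag_span k m bmul_rsarc) (E i)
    = quot_pi (diag_span k m bmul_rsarc) (\sum_i c i *: E i).
  by rewrite quot_pi_sum; apply: eq_bigr => i _; rewrite quot_piZ.
exists (fun i => quot_pi _ (E i)); split.
- move=> i; exists (quot_pi _ (E i)); rewrite [RHS]quot_actE; congr quot_pi.
  by apply: val_inj; rewrite /= amul1U eqxx.
- move=> c; rewrite quotE => /quot_pi0/span_memP h i.
  (* A nonzero coefficient would give [rfull] of some subset a right sarc. *)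
  rewrite -coefE1; apply/eqP/negPn/negP => /h.
  by rewrite has_rsarcE /width /= /dwidth (eqP (valP (enum_val i))) ltnn.
move=> _ [w ->].
(* The coordinates are read off a representative; it remains to see that the difference involves
   only diagrams with a right sarc. *)
exists (fun i => (val (repr w) : Aminus k)@_(pack (rfull (enum_val i)))).
rewrite quotE -[w in LHS]quot_piK [LHS]quot_actE; apply/quot_piP/span_memP => x.
set u := repr w; set v := \sum_i _ => xv; case: (boolP (has_rsarc x)) => // nx; exfalso.
have ex : rpts x = m by exact: proj_rpts xv.
have [I eI] := (no_rsarcP ex).1 nx.
case/eqP: xv; rewrite [val _]/= mcoeffB mcoeff_amul1l.
have [en|ne] := eqVneq (lpts x) n.
  rewrite eI; move: I {eI}; rewrite en => I.
  by rewrite -[I]enum_rankK coefE1 subrr.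
(* For another number of left points, [aone k n] kills the first term, and no basis diagram equals
   [x]. *)
rewrite sub0r coefE big1 ?oppr0 // => i _.
case: eqP => [e|]; last by rewrite mulr0.
by rewrite -e eqxx in ne.
Qed.

Lemma simple_mult_standard : simple_mult (standard k m) n = 'C(n, m).
Proof.
apply: xget_unique; first exact: has_dim_standard.
by move=> d hd; apply: has_dim_unique hd has_dim_standard.
Qed.

End Standard.

(** * Multiplicities and reciprocity *)

Lemma P_layer_mult (k : fieldType) n m c :
  amod_iso (P_layer k n m) (copies c (standard k m)) <-> c = 'C(n, m).
Proof.
have iso := P_layer_iso k n m; rewrite card_draw in iso.
split=> [h|->//]; apply: amod_iso_copies_inj h iso.
(* The copies are counted in weight [m], where the standard module has dimension 'C(m, m) = 1. *)
by rewrite -[1%N](binn m); apply: has_dim_standard.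
Qed.

Lemma standard_mult_bin (k : fieldType) n m : standard_mult k n m = 'C(n, m).
Proof.
(* For [m > n], the conventional value 0 agrees with the binomial coefficient. *)
rewrite /standard_mult; case: ifP => [_|/negbT]; last by rewrite -ltnNge => /bin_small.
by apply: xget_unique => [|c]; rewrite P_layer_mult.
Qed.

Theorem mainTheorem1 (k : fieldType) (n : nat) :
  [/\ P_le k n n =i predT,
      forall m : nat, (m <= n)%N ->
        {subset P_le k n (m%:Z - 1) <= P_le k n m},
      P_le k n (- 1) =i pred1 0
    & forall m : nat, (m <= n)%N ->
        exists! c : nat, amod_iso (P_layer k n m) (copies c (standard k m))]
  /\ (forall m : nat,
      [/\ exists d : nat, has_dim (@weight_space k (standard k m) n) d,
          standard_mult k n m = simple_mult (standard k m) n
        & simple_mult (standard k m) n = 'C(n, m)]).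
Proof.
split; last first.
  move=> m; rewrite standard_mult_bin simple_mult_standard.
  by split=> //; exists 'C(n, m); apply: has_dim_standard.
split.
- move=> v; rewrite [RHS]inE; apply/span_memP => x xv.
  rewrite -(proj_rpts xv); exact: width_rpts.
- move=> m _ v /span_memP h; apply/span_memP => x /h.
  by move=> /le_trans; apply; rewrite gerBl.
- move=> v; rewrite [RHS]inE; apply/idP/eqP => [/span_memP h|->]; last exact: rpred0.
  (* A diagram in the support would have width at most -1. *)
  apply/val_inj/malgP => x; rewrite mcoeff0; apply/eqP/negPn/negP => /h.
  by [].
- move=> m _; exists 'C(n, m); split=> [|c]; first exact/P_layer_mult.
  by move=> /P_layer_mult.
Qed.
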